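(* Let $\mathcal{P}^{(1)}$ and $\mathcal{P}^{(2)}$ be PTRSs with $\Sigma^{\mathcal{P}^{(1)}}\cap\Sigma^{\mathcal{P}^{(2)}}=\emptyset$. Then $\mathtt{AST}(\xrightarrow{\mathbf{i}}_{\mathcal{P}^{(1)}\cup\mathcal{P}^{(2)}})$ holds if and only if both $\mathtt{AST}(\xrightarrow{\mathbf{i}}_{\mathcal{P}^{(1)}})$ and $\mathtt{AST}(\xrightarrow{\mathbf{i}}_{\mathcal{P}^{(2)}})$ hold.
   Context: For a PTRS $\mathcal{P}$, $\Sigma^{\mathcal{P}}$ is the set of function symbols occurring in its rules, and $\mathcal{P}$ is considered on terms over $\Sigma^{\mathcal{P}}$ and a countable variable set. $\mathrm{FDist}(A)$: finite multisets of pairs $(p:a)$, $0<p\le1$, probabilities summing to 1; $p\cdot\mu$ as usual. A PTRS is a countable set of rules $\ell\to\mu$, $\ell$ non-variable, $\mu$ a finite multi-distribution on terms, variables of terms in $\mu$ among those of $\ell$. $t\xrightarrow{\mathbf{i}}_{\mathcal{P}}\{p_1:t_1,\dots,p_k:t_k\}$ iff $t|_\pi=\ell\sigma$, $t_j=t[r_j\sigma]_\pi$ for some position $\pi$, rule $\ell\to\{p_1:r_1,\dots,p_k:r_k\}\in\mathcal{P}$, substitution $\sigma$, where all proper subterms of $\ell\sigma$ are normal forms (terms to which no rule of $\mathcal{P}$ applies at any position). Lifting $\rightrightarrows$ of $\to$: smallest relation on multi-distributions with $\{1:t\}\rightrightarrows\{1:t\}$ for normal forms, $\{1:t\}\rightrightarrows\mu$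 if $t\to\mu$, closed under $\bigcup_jp_j\cdot\mu_j\rightrightarrows\bigcup_jp_j\cdot\nu_j$ ($\sum p_j=1$). $|\mu|_\to$: total probability of normal forms in $\mu$. $\mathtt{AST}(\to)$: every infinite $\rightrightarrows$-sequence $(\mu_n)$ satisfies $\lim_n|\mu_n|_\to=1$. *)

(* Defs.v *)
From HB Require Import structures.
From mathcomp Require Import all_boot all_order all_algebra.
From mathcomp Require Import finmap multiset.
From mathcomp Require Import all_classical all_reals all_analysis.

Set Implicit Arguments.
Unset Strict Implicit.
Unset Printing Implicit Defensive.

Import Order.TTheory GRing.Theory Num.Theory.
Import numFieldNormedType.Exports.

Local Open Scope classical_set_scope.
Local Open Scope ring_scope.

(* The pair (p, a) stands for the entry  p : a  of a multi-distribution. *)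
Definition multidist (R : realType) (A : choiceType) := multiset (R * A)%type.
Identity Coercion multiset_of_multidist : multidist >-> multiset.

Section MultiDistributions.
Variable R : realType.
Local Notation multidist := (multidist R).

Section Operations.
Variables A B : choiceType.

Definition is_fdist (D : set A) (mu : multidist A) : Prop :=
  [/\ forall p a, (p, a) \in mu -> 0 < p <= 1,
      forall p a, (p, a) \in mu -> D a
    & \sum_(x <- mu) x.1 = 1].

(* seq_mset keeps multiplicities, so pairs that become equal are not merged. *)
Definition multidist_map (f : A -> B) (mu : multidist A) : multidist B :=
  seq_mset [seq (x.1, f x.2) | x <- mu].

Definition multidist_scale (p : R) (mu : multidist A) : multidist A :=
  seq_mset [seq (p * x.1, x.2) | x <- mu].

(* msetD adds multiplicities: it is the union of multisets. *)
Definition multidist_convex k (p : 'I_k -> R) (mu : 'I_k -> multidist A) : multidist A :=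
  \big[msetD/mset0]_(j < k) multidist_scale (p j) (mu j).

End Operations.

Section Lifting.
Variables (A : choiceType) (step : A -> multidist A -> Prop).

Definition normal_form : set A := [set a | forall mu, ~ step a mu].

Inductive lifting : multidist A -> multidist A -> Prop :=
| lifting_nf a : normal_form a -> lifting [mset (1, a)]%mset [mset (1, a)]%mset
| lifting_step a mu : step a mu -> lifting [mset (1, a)]%mset mu
| lifting_convex k (p : 'I_k -> R) (mu nu : 'I_k -> multidist A) :
    (forall j, 0 < p j <= 1) -> \sum_(j < k) p j = 1 ->
    (forall j, lifting (mu j) (nu j)) ->
    lifting (multidist_convex p mu) (multidist_convex p nu).

Definition nf_prob (mu : multidist A) : R :=
  \sum_(x <- mu | `[< normal_form x.2 >]) x.1.

(* Almost-sure termination of step, viewed as a relation on the carrier D. *)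
Definition AST (D : set A) : Prop :=
  forall mu : nat -> multidist A,
    (forall n, is_fdist D (mu n)) ->
    (forall n, lifting (mu n) (mu n.+1)) ->
    (fun n => nf_prob (mu n)) @ \oo --> (1 : R).

End Lifting.
End MultiDistributions.

Section Terms.
Variables (F : Type) (ar : F -> nat).

Inductive term : Type :=
| TVar of nat
| TFun (f : F) of ('I_(ar f) -> term).

HB.instance Definition _ := gen_eqMixin term.
HB.instance Definition _ := gen_choiceMixin term.

Definition is_var (t : term) : bool := if t is TVar _ then true else false.

Fixpoint vars (t : term) : set nat :=
  match t with
  | TVar x => [set x]
  | TFun f ts => \bigcup_(i in [set: 'I_(ar f)]) vars (ts i)
  end.

Fixpoint fsyms (t : term) : set F :=
  match t with
  | TVar _ => set0
  | TFun f ts => [set f] `|` \bigcup_(i in [set: 'I_(ar f)]) fsyms (ts i)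
  end.

Definition terms_over (S : set F) : set term := [set t | fsyms t `<=` S].

Fixpoint subst (s : nat -> term) (t : term) : term :=
  match t with
  | TVar x => s x
  | TFun f ts => TFun (fun i => subst s (ts i))
  end.

(* Positions are sequences of argument indices, counted from 0;
   subterm_at t pi = None when pi is not a position of t. *)
Fixpoint subterm_at (t : term) (pi : seq nat) : option term :=
  match pi, t with
  | [::], _ => Some t
  | i :: pi', TFun f ts =>
      if insub i is Some j then subterm_at (ts j) pi' else None
  | _ :: _, TVar _ => None
  end.

(* t[u]_pi; equal to t when pi is not a position of t. *)
Fixpoint replace_at (t : term) (pi : seq nat) (u : term) : term :=
  match pi, t with
  | [::], _ => u
  | i :: pi', TFun f ts =>
      TFun (fun j : 'I_(ar f) =>
             if j == i :> nat then replace_at (ts j) pi' u else ts j)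
  | _ :: _, TVar _ => t
  end.

End Terms.

Arguments TVar {F ar}.
Arguments TFun {F ar}.

Section PTRS.
Variables (R : realType) (F : Type) (ar : F -> nat).

Definition rule : Type := (term ar * multidist R (term ar))%type.

Definition is_PTRS (P : set rule) : Prop :=
  countable P /\
  forall l mu, P (l, mu) ->
    [/\ ~~ is_var l, is_fdist setT mu
      & forall p r, (p, r) \in mu -> vars r `<=` vars l].

Definition signature (P : set rule) : set F :=
  [set f | exists l mu, P (l, mu) /\
     (fsyms l f \/ exists p r, (p, r) \in mu /\ fsyms r f)].

Definition normal_term (P : set rule) (t : term ar) : Prop :=
  ~ exists pi l mu s, P (l, mu) /\ subterm_at t pi = Some (subst s l).

Definition innermost (P : set rule) (t : term ar) (mu : multidist R (term ar)) :
    Prop :=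
  exists pi l nu s,
    [/\ P (l, nu),
        subterm_at t pi = Some (subst s l),
        forall pi' u, pi' <> [::] -> subterm_at (subst s l) pi' = Some u ->
          normal_term P u
      & mu = multidist_map (fun r => replace_at t pi (subst s r)) nu].

Definition innermost_AST (P : set rule) : Prop :=
  AST (innermost P) (terms_over (signature P)).

End PTRS.

(* Main.v *)
Require Import Defs.
From mathcomp Require Import all_boot all_order all_algebra.
From mathcomp Require Import finmap multiset.
From mathcomp Require Import all_classical all_reals all_analysis.
From mathcomp Require Import ring lra.

Set Implicit Arguments.
Unset Strict Implicit.
Unset Printing Implicit Defensive.

Import Order.TTheory GRing.Theory Num.Theory.
Import numFieldNormedType.Exports.

Local Open Scope classical_set_scope.
Local Open Scope ring_scope.

(* Almost-sure termination is equivalent to a Liouville property: a function g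
   with values in [0,1] such that g a <= sup_(a -> mu) E_mu[g] (read as
   g a <= 0 when a is a normal form) vanishes. If such a g is positive at a,
   almost optimal choices of steps keep its expectation bounded away from 0,
   hence also the probability of not having reached a normal form. Conversely,
   the largest escape probability of a rewrite sequence started in a is such a
   function. This replaces rewrite sequences and their schedulers by functional
   inequalities.

   For the union of two disjoint systems, every term is shown to lie in a set
   that is closed under steps and has the Liouville property, by induction on
   the term. In f(t_1,...,t_n) the arguments are rewritten in an interleaved
   way, and the Liouville property passes to interleavings. Once all arguments
   are normal, the term is an instance s(t) where t is built from the symbols
   of the system owning f, and s maps variables injectively to normal forms with
   roots outside this signature; innermost steps of s(t) are then exactly the
   instances of innermost steps of t in that single system. *)

(** * Choice of sequences, suprema and permuted lists *)

Lemma dependent_choice_nat (T : Type) (Inv : nat -> T -> Prop)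
    (next : T -> T -> Prop) (x0 : T) :
  Inv 0%N x0 ->
  (forall n x, Inv n x -> exists y, Inv n.+1 y /\ next x y) ->
  exists u : nat -> T,
    u 0%N = x0 /\ forall n, Inv n (u n) /\ next (u n) (u n.+1).
Proof.
move=> inv0 invS.
have /choice[c cP] : forall nx : nat * T, exists y,
    Inv nx.1 nx.2 -> Inv nx.1.+1 y /\ next nx.2 y.
  move=> [n x] /=.
  have [/invS[y ?]|ninv] := pselect (Inv n x); first by exists y.
  by exists x.
pose u := fix u n := if n is m.+1 then c (m, u m) else x0.
have uInv n : Inv n (u n) by elim: n => //= n /(cP (n, u n))[].
by exists u; split=> // n; split=> //; have [] := cP (n, u n) (uInv n).
Qed.

(* A bounded set of reals is enlarged by 0, so that it has a supremum even
   when it is empty. *)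
Lemma exists_sup0 (R : realType) (E : set R) :
  (forall x, E x -> x <= 1) ->
  exists s : R, [/\ 0 <= s <= 1, forall x, E x -> x <= s
    & forall e, 0 < e -> s <= e \/ exists x, E x /\ s <= x + e].
Proof.
move=> E1; pose E0 := [set 0] `|` E.
have E00 : E0 0 by left.
have supE : has_sup E0.
  by split; [exists 0|exists 1 => x [->|/E1//]; rewrite ler01].
have ubE x : E0 x -> x <= sup E0 by apply: ub_le_sup; case: supE.
exists (sup E0); split=> [|x Ex|e e0].
- rewrite ubE//=; apply: ge_sup; first by exists 0.
  by move=> x [->|/E1//]; rewrite ler01.
- by apply: ubE; right.
- have [x [->|Ex] /ltW xe] := sup_adherent e0 supE; first by left; lra.
  by right; exists x; split=> //; lra.
Qed.

(** Lets data attached to the entries of a list follow a permutation of these entries. *)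
Lemma perm_map_lift (T U : eqType) (f : T -> U) (s : seq U) (t : seq T) :
  perm_eq s (map f t) -> exists t', perm_eq t' t /\ s = map f t'.
Proof.
case: t => [|x0 t]; first by move/perm_nilP->; exists [::].
move=> /(perm_iotaP (f x0))[Is]; rewrite size_map => IsP ->.
exists [seq nth x0 (x0 :: t) i | i <- Is]; split.
  by apply/(perm_iotaP x0); exists Is.
rewrite -map_comp; apply/eq_in_map => i.
rewrite (perm_mem IsP) mem_iota => iP.
by rewrite (nth_map x0).
Qed.

(** * Expectations of multi-distributions *)

Section Expectation.
Variable R : realType.

(** Defined on lists, so that it applies both to multisets and to the ordered, not necessarily
    normalised, families followed in [process]. *)
Definition expect (A : Type) (s : seq (R * A)) (g : A -> R) : R :=
  \sum_(x <- s) x.1 * g x.2.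

Definition scale_seq (A : Type) (p : R) (s : seq (R * A)) : seq (R * A) :=
  [seq (p * x.1, x.2) | x <- s].

Section Basics.
Variable A : choiceType.
Implicit Types (s t : seq (R * A)) (g h : A -> R) (mu nu : multidist R A).

Lemma expect_perm s t g : perm_eq s t -> expect s g = expect t g.
Proof. exact: perm_big. Qed.

Lemma expect_cat s t g : expect (s ++ t) g = expect s g + expect t g.
Proof. by rewrite /expect big_cat. Qed.

Lemma expect1 (p : R) (a : A) g : expect [:: (p, a)] g = p * g a.
Proof. by rewrite /expect big_seq1. Qed.

Lemma expect_mset1 (a : A) g : expect [mset (1 : R, a)]%mset g = g a.
Proof. by rewrite enum_msetn expect1 mul1r. Qed.

Lemma expect_scale p s g : expect (scale_seq p s) g = p * expect s g.
Proof.
rewrite /expect /scale_seq big_map mulr_sumr.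
by apply: eq_bigr => x _; rewrite mulrA.
Qed.

Lemma expect_flatten (I : Type) (r : seq I) (F : I -> seq (R * A)) g :
  expect (flatten [seq F i | i <- r]) g = \sum_(i <- r) expect (F i) g.
Proof.
elim: r => [|i r IH]; first by rewrite /expect !big_nil.
by rewrite /= expect_cat IH big_cons.
Qed.

Lemma expect_const s (c : R) :
  expect s (fun=> c) = (\sum_(x <- s) x.1) * c.
Proof. by rewrite /expect mulr_suml. Qed.

Lemma expectD s g h :
  expect s (fun a => g a + h a) = expect s g + expect s h.
Proof.
by rewrite /expect -big_split; apply: eq_bigr => x _; rewrite mulrDr.
Qed.

Lemma ler_expect s g h :
  (forall x, x \in s -> 0 <= x.1) -> (forall x, x \in s -> g x.2 <= h x.2) ->
  expect s g <= expect s h.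
Proof.
move=> s0 gh; rewrite /expect big_seq [leRHS]big_seq.
by apply: ler_sum => x xs; rewrite ler_wpM2l ?s0 ?gh.
Qed.

Lemma expect_ge0 s g :
  (forall x, x \in s -> 0 <= x.1) -> (forall x, x \in s -> 0 <= g x.2) ->
  0 <= expect s g.
Proof.
move=> s0 g0; rewrite /expect big_seq sumr_ge0// => x xs.
by rewrite mulr_ge0 ?s0 ?g0.
Qed.

Lemma perm_msetD (T : choiceType) (M N : multiset T) :
  perm_eq (M `+` N)%mset (M ++ N).
Proof.
apply/allP => x _ /=; apply/eqP.
by rewrite count_cat !count_mem_mset msetE2.
Qed.

Lemma perm_scale p mu : perm_eq (multidist_scale p mu) (scale_seq p mu).
Proof. exact: perm_eq_seq_mset. Qed.

Lemma perm_convex k (p : 'I_k -> R) (mu : 'I_k -> multidist R A) :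
  perm_eq (multidist_convex p mu)
          (flatten [seq scale_seq (p j) (mu j) | j <- index_enum 'I_k]).
Proof.
rewrite /multidist_convex; elim: (index_enum _) => [|j r IH].
  by rewrite big_nil enum_mset0.
rewrite big_cons /=; apply: perm_trans (perm_msetD _ _) _.
by rewrite perm_cat ?perm_scale.
Qed.

Lemma perm_mset_eq mu nu : perm_eq mu nu -> mu = nu.
Proof. by move/eq_seq_msetP; rewrite !seq_mset_id. Qed.

Lemma expect_convex k (p : 'I_k -> R) (mu : 'I_k -> multidist R A) g :
  expect (multidist_convex p mu) g = \sum_j p j * expect (mu j) g.
Proof.
rewrite (expect_perm _ (perm_convex p mu)) expect_flatten.
by apply: eq_bigr => j _; rewrite expect_scale.
Qed.

Section FDist.
Variables (D : set A) (mu : multidist R A).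
Hypothesis muD : is_fdist D mu.

Lemma fdist_ge0 x : x \in mu -> 0 <= x.1.
Proof.
case: x => p a xmu; have [h _ _] := muD.
by have /andP[/ltW] := h _ _ xmu.
Qed.

Lemma fdist_supp x : x \in mu -> D x.2.
Proof. by case: x => p a xmu; have [_ h _] := muD; exact: h xmu. Qed.

Lemma expect_fdist_const c : expect mu (fun=> c) = c.
Proof. by rewrite expect_const; case: muD => _ _ ->; rewrite mul1r. Qed.

Lemma ler_expect_fdist g h :
  (forall a, D a -> g a <= h a) -> expect mu g <= expect mu h.
Proof.
move=> gh; apply: ler_expect => x xmu; first exact: fdist_ge0.
by apply: gh; exact: fdist_supp.
Qed.

Lemma expect_fdist_ge0 g : (forall a, D a -> 0 <= g a) -> 0 <= expect mu g.
Proof. by move=> /ler_expect_fdist; rewrite expect_fdist_const. Qed.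

Lemma expect_fdist_le1 g : (forall a, D a -> g a <= 1) -> expect mu g <= 1.
Proof. by move=> /ler_expect_fdist; rewrite expect_fdist_const. Qed.

End FDist.

Lemma fdist_mset1 (D : set A) (a : A) :
  D a -> is_fdist D ([mset (1 : R, a)]%mset : multidist R A).
Proof.
move=> Da; split=> [p b|p b|].
- by rewrite in_mset1 => /eqP[-> _]; rewrite ltr01 lexx.
- by rewrite in_mset1 => /eqP[_ ->].
- by rewrite enum_msetn big_seq1.
Qed.

Lemma fdist_convex (D : set A) k (p : 'I_k -> R) (mu : 'I_k -> multidist R A) :
  (forall j, 0 < p j <= 1) -> \sum_j p j = 1 ->
  (forall j, is_fdist D (mu j)) -> is_fdist D (multidist_convex p mu).
Proof.
move=> p01 p1 muD.
have mem x : x \in multidist_convex p mu ->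
    exists j y, [/\ y \in mu j, x.1 = p j * y.1 & x.2 = y.2].
  rewrite -[x \in _]/(x \in enum_mset _) (perm_mem (perm_convex p mu)).
  by case/flatten_mapP => j _ /mapP[y ymu ->]; exists j, y.
split=> [q a|q a|].
- case/mem => j [[r b] [/= rb -> _]]; have [/(_ _ _ rb)/andP[r0 r1] _ _] := muD j.
  have /andP[pj0 pj1] := p01 j.
  by rewrite mulr_gt0//= mulr_ile1// ltW.
- case/mem => j [[r b] [/= rb _ ->]]; exact: (fdist_supp (muD j) rb).
- rewrite -[LHS]mulr1 -expect_const expect_convex -[RHS]p1.
  by apply: eq_bigr => j _; rewrite (expect_fdist_const (muD j)) mulr1.
Qed.

End Basics.

Section Map.
Variables A B C : choiceType.

Lemma expect_map (f : A -> B) (mu : multidist R A) (g : B -> R) :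
  expect (multidist_map f mu) g = expect mu (g \o f).
Proof.
by rewrite (expect_perm _ (perm_eq_seq_mset _)) /expect big_map.
Qed.

Lemma multidist_map_comp (f : B -> C) (h : A -> B) (mu : multidist R A) :
  multidist_map f (multidist_map h mu) = multidist_map (f \o h) mu.
Proof.
apply/eq_seq_msetP.
apply: perm_trans (perm_map _ (perm_eq_seq_mset _)) _.
by rewrite -map_comp.
Qed.

Lemma eq_multidist_map (f h : A -> B) (mu : multidist R A) :
  (forall p a, (p, a) \in mu -> f a = h a) ->
  multidist_map f mu = multidist_map h mu.
Proof.
by move=> fh; congr seq_mset; apply/eq_in_map => -[p a] /fh /= ->.
Qed.

Lemma fdist_map (D : set A) (E : set B) (f : A -> B) (mu : multidist R A) :
  is_fdist D mu -> (forall p a, (p, a) \in mu -> E (f a)) ->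
  is_fdist E (multidist_map f mu).
Proof.
move=> muD fE.
have mem x : x \in multidist_map f mu -> exists2 y, y \in mu & x = (y.1, f y.2).
  rewrite -[x \in _]/(x \in enum_mset _) (perm_mem (perm_eq_seq_mset _)).
  by case/mapP => y; exists y.
split=> [p b|p b|].
- by case/mem => -[q a] qa /= [-> _]; have [/(_ _ _ qa)] := muD.
- by case/mem => -[q a] qa /= [_ ->]; exact: fE qa.
- by rewrite -[LHS]mulr1 -expect_const expect_map (expect_fdist_const muD).
Qed.

End Map.
End Expectation.

(** * Subharmonic functions and the Liouville property *)

Definition step_closed (R : realType) (A : choiceType)
    (step : A -> multidist R A -> Prop) (D : set A) : Prop :=
  forall a mu, D a -> step a mu -> is_fdist D mu.

(* Up to an arbitrarily small loss, g does not decrease in expectation along a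
   suitable step, unless g a <= 0. *)
Definition subharmonic (R : realType) (A : choiceType)
    (step : A -> multidist R A -> Prop) (D : set A) (g : A -> R) : Prop :=
  forall a, D a -> 0 <= g a <= 1 /\
    forall e, 0 < e ->
      g a <= e \/ exists mu : multidist R A, step a mu /\ g a <= expect mu g + e.

Definition liouville (R : realType) (A : choiceType)
    (step : A -> multidist R A -> Prop) (D : set A) : Prop :=
  forall g, subharmonic step D g -> forall a, D a -> g a <= 0.

Lemma ler0_eps (R : realType) (x : R) : (forall e, 0 < e -> x <= e) -> x <= 0.
Proof. by move=> xe; apply/ler_addgt0Pl => e e0; rewrite addr0 xe. Qed.

Section Restriction.
Variables (R : realType) (A : choiceType).
Implicit Types (D E : set A) (step : A -> multidist R A -> Prop).

Lemma fdist_sub D E (mu : multidist R A) :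
  D `<=` E -> is_fdist D mu -> is_fdist E mu.
Proof. by move=> DE [? muD ?]; split=> // p a /muD/DE. Qed.

Lemma subharmonic_sub step D E g :
  D `<=` E -> subharmonic step E g -> subharmonic step D g.
Proof. by move=> DE gE a /DE/gE. Qed.

(** Extending [g] by 0 outside [D] keeps it subharmonic: the value 0 asks for no step, and steps
    from [D] stay in [D], where expectations do not change. *)
Lemma liouville_restrict step step' D E :
  D `<=` E -> step_closed step D ->
  (forall a mu, D a -> step a mu -> step' a mu) ->
  liouville step' E -> liouville step D.
Proof.
move=> DE Dstep stepS liou g gsub a Da.
pose g' b := if `[< D b >] then g b else 0.
have g'E b : D b -> g' b = g b by move=> /asboolP Db; rewrite /g' Db.
rewrite -g'E//; apply: liou (DE _ Da) => {Da} {}a _.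
have [Da|Da] := pselect (D a); last first.
  have -> : g' a = 0 by rewrite /g'; case: asboolP.
  by split; [rewrite lexx ler01|move=> e /ltW; left].
have [g01 gstep] := gsub _ Da; rewrite g'E//; split=> // e e0.
have [|[mu [st gle]]] := gstep _ e0; [by left|right; exists mu].
split; first exact: stepS.
apply: le_trans gle _; rewrite lerD2r.
by apply: (ler_expect_fdist (Dstep _ _ Da st)) => b Db; rewrite g'E.
Qed.

End Restriction.

(** * Almost-sure termination as a Liouville property *)

Section Liouville.
Variables (R : realType) (A : choiceType).
Variables (step : A -> multidist R A -> Prop) (D : set A).
Hypothesis Dstep : step_closed step D.

(** For a distribution, its expectation is the weight that is still reducible, the complement of
    [nf_prob]. *)
Let nnf (a : A) : R := (~~ `[< normal_form step a >])%:R.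

Let nnf_ge0 a : 0 <= nnf a. Proof. exact: ler0n. Qed.

Let nnf_le1 a : nnf a <= 1. Proof. by rewrite lern1 leq_b1. Qed.

Let nnf0 a : normal_form step a -> nnf a = 0.
Proof. by move=> /asboolP na; rewrite /nnf na. Qed.

Let nnf1 a : ~ normal_form step a -> nnf a = 1.
Proof. by move=> /asboolPn na; rewrite /nnf na. Qed.

Lemma nf_probE (mu : multidist R A) :
  is_fdist D mu -> nf_prob step mu = 1 - expect mu nnf.
Proof.
move=> muD; rewrite -(expect_fdist_const muD 1) /nf_prob /expect -sumrB.
rewrite big_mkcond; apply: eq_bigr => x _; rewrite /nnf.
by case: asboolP => _ /=; rewrite ?mulr1 ?mulr0 ?subr0 ?subrr.
Qed.

Definition move (a : A) (mu : multidist R A) : Prop :=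
  (normal_form step a /\ mu = [mset (1, a)]%mset) \/ step a mu.

Lemma fdist_move a mu : D a -> move a mu -> is_fdist D mu.
Proof.
by move=> Da [[_ ->]|]; [exact: fdist_mset1|exact: Dstep].
Qed.

(** [mu] is the convex combination of the point masses of its entries, so one move can be chosen per
    entry; the losses average to at most [e]. *)
Lemma lifting_moves (g : A -> R) (e : R) (mu : multidist R A) :
  is_fdist D mu ->
  (forall a, D a -> exists nu, move a nu /\ g a <= expect nu g + e) ->
  exists nu, [/\ lifting step mu nu, is_fdist D nu
    & expect mu g <= expect nu g + e].
Proof.
move=> muD ge.
have /choice[c cP] : forall a, exists nu : multidist R A,
    D a -> move a nu /\ g a <= expect nu g + e.
  move=> a; have [/ge[nu ?]|nDa] := pselect (D a); first by exists nu.
  by exists mset0.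
pose t j := tnth (in_tuple mu) j.
have tmu j : t j \in mu by exact: mem_tnth.
have tD j : D (t j).2 := fdist_supp muD (tmu j).
have cD j : is_fdist D (c (t j).2).
  by apply: fdist_move (tD j) _; have [] := cP _ (tD j).
have p01 j : 0 < (t j).1 <= 1.
  by case: muD => h _ _; move: (tmu j); case: (t j) => p a /h.
have p1 : \sum_j (t j).1 = 1.
  by case: muD => _ _ <-; rewrite [RHS](big_tuple _ _ (in_tuple mu)).
have mapt : map t (index_enum 'I_(size mu)) = mu.
  by rewrite /index_enum -enumT map_tnth_enum.
have muE : mu = multidist_convex (fun j => (t j).1)
                                 (fun j => [mset (1, (t j).2)]%mset).
  apply: perm_mset_eq; rewrite perm_sym; apply: perm_trans (perm_convex _ _) _.
  rewrite -[X in perm_eq _ X]mapt -(flatten_map1 t).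
  have -> // : (fun j => scale_seq (t j).1 [mset (1, (t j).2)]%mset) =
               (fun j => [:: t j]).
  by apply/funext => j; rewrite enum_msetn /= mulr1 -surjective_pairing.
exists (multidist_convex (fun j => (t j).1) (fun j => c (t j).2)); split.
- rewrite [X in lifting _ X]muE; apply: lifting_convex => // j.
  have [[[nf ->]|st] _] := cP _ (tD j); first exact: lifting_nf.
  exact: lifting_step.
- exact: fdist_convex.
- rewrite [X in expect (EnumMset.f X)]muE !expect_convex.
  have -> : e = \sum_j (t j).1 * e by rewrite -mulr_suml p1 mul1r.
  rewrite -big_split; apply: ler_sum => j _ /=.
  have [_ gle] := cP _ (tD j); have /andP[/ltW p0 _] := p01 j.
  by rewrite expect_mset1 -mulrDr ler_wpM2l.
Qed.

Lemma AST_liouville : AST step D -> liouville step D.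
Proof.
move=> ast g gsub a0 Da0; rewrite leNgt; apply/negP => g0.
have nf_le0 a : D a -> normal_form step a -> g a <= 0.
  move=> Da nf; apply: ler0_eps => e e0.
  by have [_ /(_ _ e0)[//|[mu [/nf]]]] := gsub _ Da.
(* Hence a lower bound on the expectation of [g] also bounds the reducible weight from below. *)
have gnnf a : D a -> g a <= nnf a.
  move=> Da; have [nf|nnf'] := pselect (normal_form step a).
    by rewrite (nnf0 nf) nf_le0.
  by rewrite (nnf1 nnf'); have [/andP[]] := gsub _ Da.
pose d := g a0 / 2; have d0 : 0 < d by rewrite divr_gt0.
(* If [g a <= e], any move will do, since [g] is nonnegative on [D]. *)
have moveP e a : 0 < e -> D a -> exists nu, move a nu /\ g a <= expect nu g + e.
  move=> e0 Da; have [_ /(_ _ e0)[ge|[mu [st gmu]]]] := gsub _ Da; last first.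
    by exists mu; split=> //; right.
  have [nf|/existsNP[mu /contrapT st]] := pselect (normal_form step a).
    exists [mset (1, a)]%mset; split; first by left.
    by rewrite expect_mset1 lerDl ltW.
  exists mu; split; first by right.
  apply: le_trans ge _; rewrite lerDr.
  apply: (expect_fdist_ge0 (Dstep Da st)).
  by move=> b Db; have [/andP[]] := gsub _ Db.
(* The bound starts at [g a0 = d + d]; step [n] may lose [d / 2 ^+ n.+1], so the expectation stays
   above [d] forever. *)
pose Inv n mu := is_fdist D mu /\ d + d / 2 ^+ n <= expect mu g.
have [||u [u0 uP]] := @dependent_choice_nat _ Inv (lifting step) [mset (1, a0)]%mset.
- split; first exact: fdist_mset1.
  by rewrite expect_mset1 expr0 divr1 /d; lra.
- move=> n mu [muD mug].
  have e0 : 0 < d / 2 ^+ n.+1 by rewrite divr_gt0// exprn_gt0.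
  have [nu [munu nuD gnu]] := lifting_moves muD (fun a => @moveP _ a e0).
  exists nu; split=> //; split=> //.
  rewrite -(lerD2r (d / 2 ^+ n.+1)); apply: le_trans gnu; apply: le_trans mug.
  rewrite -addrA lerD2l le_eqVlt; apply/orP; left; apply/eqP.
  by rewrite exprS; field; rewrite expf_neq0.
have /cvgr_gt/(_ (1 - d)) : (fun n => nf_prob step (u n)) @ \oo --> (1 : R).
  by apply: ast => n; have [[]] := uP n.
rewrite ltrBlDr ltrDl => /(_ d0) [N _ /(_ N (leqnn N))] /=.
have [[uD ug] _] := uP N; rewrite nf_probE// ltrD2l ltrN2.
move=> lt_d; have := ler_expect_fdist uD gnnf.
have : 0 < d / 2 ^+ N by rewrite divr_gt0// exprn_gt0.
by lra.
Qed.

(** * Rewrite sequences as lists with traceable entries *)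

Definition children (x : R * A * multidist R A) : seq (R * A) :=
  scale_seq x.1.1 x.2.

(** List form of [lifting]: every entry makes its own move and children appear in the order of their
    parents, so the descendants of a part of the list can be followed separately. *)
Definition lift_seq (s t : seq (R * A)) : Prop :=
  exists m : seq (R * A * multidist R A),
    [/\ forall x, x \in m -> move x.1.2 x.2, s = [seq x.1 | x <- m]
      & t = flatten [seq children x | x <- m]].

Lemma lift_seq_cat s1 s2 t : lift_seq (s1 ++ s2) t ->
  exists t1 t2, [/\ t = t1 ++ t2, lift_seq s1 t1 & lift_seq s2 t2].
Proof.
move=> [m [mP sE ->]].
exists (flatten [seq children x | x <- take (size s1) m]).
exists (flatten [seq children x | x <- drop (size s1) m]).
split.
- by rewrite -flatten_cat -map_cat cat_take_drop.
- exists (take (size s1) m); split=> // [x /mem_take/mP//|].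
  by rewrite map_take -sE take_size_cat.
- exists (drop (size s1) m); split=> // [x /mem_drop/mP//|].
  by rewrite map_drop -sE drop_size_cat.
Qed.

Lemma cat_lift_seq s1 s2 t1 t2 :
  lift_seq s1 t1 -> lift_seq s2 t2 -> lift_seq (s1 ++ s2) (t1 ++ t2).
Proof.
move=> [m1 [m1P -> ->]] [m2 [m2P -> ->]]; exists (m1 ++ m2).
split; rewrite ?map_cat ?flatten_cat// => x.
by rewrite mem_cat => /orP[/m1P|/m2P].
Qed.

Lemma scale_lift_seq p s t :
  lift_seq s t -> lift_seq (scale_seq p s) (scale_seq p t).
Proof.
move=> [m [mP -> ->]]; exists [seq ((p * x.1.1, x.1.2), x.2) | x <- m].
split=> [_ /mapP[x /mP ? ->]//||]; first by rewrite /scale_seq -!map_comp.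
rewrite /scale_seq map_flatten -!map_comp; congr flatten.
apply: eq_map => x /=; rewrite -map_comp; apply: eq_map => y /=.
by rewrite mulrA.
Qed.

Lemma perm_lift_seq s s' t : perm_eq s' s -> lift_seq s t ->
  exists2 t', lift_seq s' t' & perm_eq t' t.
Proof.
move=> ss' [m [mP sE ->]]; move: ss'; rewrite {s}sE => /perm_map_lift[m' [mm' ->]].
exists (flatten [seq children x | x <- m']).
  by exists m'; split=> // x; rewrite (perm_mem mm') => /mP.
by apply: perm_flatten; apply: perm_map.
Qed.

Lemma lift_seq1 (a : A) (mu : multidist R A) :
  move a mu -> lift_seq [:: (1, a)] mu.
Proof.
move=> amu; exists [:: ((1, a), mu)]; split=> //= [x|].
  by rewrite inE => /eqP->.
rewrite cats0 /scale_seq -[LHS]map_id; apply: eq_map => x.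
by rewrite mul1r -surjective_pairing.
Qed.

(** Allowing any ordering [s] of [mu] makes the statement iterable: the list obtained for [nu] is
    again an ordering from which the next step can start. *)
Lemma lifting_lift_seq mu nu : lifting step mu nu ->
  forall s, perm_eq s mu -> exists2 t, lift_seq s t & perm_eq t nu.
Proof.
have lift1 (a : A) (mu' : multidist R A) s : move a mu' ->
    perm_eq s [mset (1 : R, a)]%mset -> exists2 t, lift_seq s t & perm_eq t mu'.
  move=> amu; rewrite enum_msetn => sP.
  exact: perm_lift_seq sP (lift_seq1 amu).
elim=> {mu nu} [a na|a mu st|k p mu nu p01 p1 _ IH] s sP.
- by apply: lift1 sP; left.
- by apply: lift1 sP; right.
- have /choice[t tP] : forall j, exists t, lift_seq (mu j) t /\ perm_eq t (nu j).
    by move=> j; have [t] := IH j _ (perm_refl _); exists t.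
  have flat : lift_seq (flatten [seq scale_seq (p j) (mu j) | j <- index_enum 'I_k])
                       (flatten [seq scale_seq (p j) (t j) | j <- index_enum 'I_k]).
    elim: (index_enum _) => [|j r IHr] /=; first by exists [::].
    by apply: cat_lift_seq => //; apply: scale_lift_seq; have [] := tP j.
  have [t' st' t'P] := perm_lift_seq (perm_trans sP (perm_convex p mu)) flat.
  exists t' => //; apply: perm_trans t'P _; rewrite perm_sym.
  apply: perm_trans (perm_convex p nu) _.
  elim: (index_enum _) => //= j r IHr; apply: perm_cat => //.
  by apply: perm_map; rewrite perm_sym; have [] := tP j.
Qed.

(** Weights need not sum to 1, so the descendants of a part of a process form a process. *)
Definition process (L : nat -> seq (R * A)) : Prop :=
  (forall n, lift_seq (L n) (L n.+1)) /\
  forall n x, x \in L n -> 0 < x.1 /\ D x.2.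

Lemma process_shift L : process L -> process (fun n => L n.+1).
Proof. by move=> [Lstep LD]; split=> n; [exact: Lstep|exact: LD]. Qed.

Lemma process_cat L s t : process L -> L 0%N = s ++ t ->
  exists L1 L2, [/\ process L1 /\ process L2, L1 0%N = s, L2 0%N = t
    & forall n, L n = L1 n ++ L2 n].
Proof.
move=> [Lstep LD] L0.
pose Inv n (st : seq (R * A) * seq (R * A)) := L n = st.1 ++ st.2.
pose next (st st' : seq (R * A) * seq (R * A)) :=
  lift_seq st.1 st'.1 /\ lift_seq st.2 st'.2.
have [||u [u0 uP]] := @dependent_choice_nat _ Inv next (s, t) => //.
  move=> n [s1 s2]; rewrite /Inv /= => LE.
  have := Lstep n; rewrite LE => /lift_seq_cat[t1 [t2 [LE' st1 st2]]].
  by exists (t1, t2).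
exists (fun n => (u n).1), (fun n => (u n).2); rewrite u0; split=> //; last first.
  by move=> n; have [] := uP n.
split; (split=> n; first by have [_ []] := uP n) => x xL; apply: (LD n);
  by have [-> _] := uP n; rewrite mem_cat xL ?orbT.
Qed.

Section OneProcess.
Variable L : nat -> seq (R * A).
Hypothesis LP : process L.

Lemma process_ge0 n x : x \in L n -> 0 <= x.1.
Proof. by have [_ LD] := LP; case/LD => /ltW. Qed.

Lemma process_expect_nnf_ge0 n : 0 <= expect (L n) nnf.
Proof. by apply: expect_ge0 => x /process_ge0. Qed.

(** The children of an entry share its weight: a reducible entry already counts in full, and a
    normal one is its own only child. *)
Lemma process_expect_nnf_noninc : nonincreasing_seq (fun n => expect (L n) nnf).
Proof.
apply/nonincreasing_seqP => n; have [Lstep LD] := LP.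
have [m [mP sE ->]] := Lstep n; rewrite sE expect_flatten.
rewrite /expect [leRHS]big_map big_seq [leRHS]big_seq.
apply: ler_sum => x xm; rewrite -/(expect _ _) expect_scale.
have [p0 Da] : 0 < x.1.1 /\ D x.1.2 by apply: (LD n); rewrite sE map_f.
apply: ler_wpM2l; first exact: ltW.
have xD := fdist_move Da (mP _ xm).
have [nf|nnf'] := pselect (normal_form step x.1.2); last first.
  by rewrite (nnf1 nnf'); apply: (expect_fdist_le1 xD).
by have [[_ ->]|/nf//] := mP _ xm; rewrite expect_mset1.
Qed.

Lemma process_cvg : cvgn (fun n => expect (L n) nnf).
Proof.
apply: nonincreasing_is_cvgn; first exact: process_expect_nnf_noninc.
by exists 0 => _ [n _ <-]; exact: process_expect_nnf_ge0.
Qed.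

(** The weight that never reaches a normal form. *)
Definition escape : R := limn (fun n => expect (L n) nnf).

Lemma escape_le n : escape <= expect (L n) nnf.
Proof. exact: nonincreasing_cvgn_ge process_expect_nnf_noninc process_cvg n. Qed.

Lemma escape_ge0 : 0 <= escape.
Proof.
by apply: (limr_ge process_cvg); apply: nearW => n; exact: process_expect_nnf_ge0.
Qed.

End OneProcess.

Lemma escape_shift L : process L -> escape (fun n => L n.+1) = escape L.
Proof.
move=> LP; apply/cvg_lim => //.
by have := process_cvg LP; rewrite -(cvg_shiftS (fun n => expect (L n) nnf)).
Qed.

Lemma escape_cat L L1 L2 : process L1 -> process L2 ->
  (forall n, L n = L1 n ++ L2 n) -> escape L = escape L1 + escape L2.
Proof.
move=> P1 P2 LE; rewrite /escape -limD; [|exact: process_cvg..].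
have -> // : (fun n => expect (L n) nnf) =
             (fun n => expect (L1 n) nnf) \+ (fun n => expect (L2 n) nnf).
by apply/funext => n /=; rewrite LE expect_cat.
Qed.

(** The supremum [g a] of the relative escape from [a] is subharmonic: after one step to [mu],
    escape is additive over the entries of [mu], hence bounded by the expectation of [g]. The
    Liouville property makes it vanish on [D]. *)
Lemma liouville_AST : liouville step D -> AST step D.
Proof.
move=> liou.
(* Dividing by [p] allows any starting weight, as the entries of a split process carry different
   weights. *)
pose E a := [set r | exists L p, [/\ 0 < p, process L, L 0%N = [:: (p, a)]
                                & r = escape L / p]].
have E1 a r : E a r -> r <= 1.
  move=> [L [p [p0 LP L0 ->]]]; rewrite ler_pdivrMr// mul1r.
  by apply: le_trans (escape_le LP 0) _; rewrite L0 expect1 ler_piMr// ltW.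
have /choice[g gP] : forall a, exists s, _ := fun a => exists_sup0 (@E1 a).
(* Entries are split off one at a time; each contributes at most its weight times [g]. *)
have escape_expect L : process L -> escape L <= expect (L 0%N) g.
  move sE : (L 0%N) => s; elim: s L sE => [|[p a] s IH] L L0 LP.
    by have := escape_le LP 0; rewrite L0 /expect !big_nil.
  have [L1 [L2 [[P1 P2] L10 L20 LE]]] := process_cat LP (L0 : _ = [:: _] ++ _).
  rewrite (escape_cat P1 P2 LE) -[_ :: _]/([:: _] ++ _) expect_cat lerD ?IH//.
  have [p0 _] : 0 < p /\ D a.
    by have [_ /(_ 0%N (p, a))] := LP; rewrite L0 mem_head; apply.
  rewrite expect1 [p * _]mulrC -ler_pdivrMr//; have [_ ubg _] := gP a.
  by apply: ubg; exists L1, p.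
have gsub : subharmonic step D g.
  move=> a Da; have [g01 _ gsup] := gP a; split=> // e e0.
  have [|[_ [[L [p [p0 LP L0 ->]]] ge]]] := gsup _ e0; first by left.
  have [/(_ 0%N) + _] := LP.
  rewrite L0 => -[m [mP mE L1]].
  case: m mE mP L1 => [//|[[q b] mu] [|//]] [<- <-] mP L1.
  have /= [[na _]|st] := mP _ (mem_head _ _).
    left; apply: le_trans ge _; rewrite -lerBrDr subrr ler_pdivrMr// mul0r.
    by have := escape_le LP 0; rewrite L0 expect1 (nnf0 na) mulr0.
  right; exists mu; split=> //; apply: le_trans ge _; rewrite lerD2r.
  rewrite ler_pdivrMr// [_ * p]mulrC -(escape_shift LP).
  have := escape_expect _ (process_shift LP).
  by rewrite L1 /= cats0 expect_scale.
move=> mu muD mulift.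
have [||L [L0 LP']] := @dependent_choice_nat _
  (fun n s => perm_eq s (mu n)) lift_seq (mu 0%N) => //.
  by move=> n s /(lifting_lift_seq (mulift n))[t]; exists t.
have LP : process L.
  split=> n; first by have [] := LP' n.
  move=> [p a]; have [/perm_mem -> _] := LP' n => pa.
  by have [h1 h2 _] := muD n; have /andP[] := h1 _ _ pa; have := h2 _ _ pa.
have esc0 : escape L = 0.
  apply/eqP; rewrite eq_le escape_ge0// andbT.
  apply: le_trans (escape_expect _ LP) _; rewrite L0.
  rewrite -(expect_fdist_const (muD 0%N) 0).
  by apply: (ler_expect_fdist (muD 0%N)) => a; apply: liou.
have -> : (fun n => nf_prob step (mu n)) = (fun n => 1 - expect (L n) nnf).
  apply/funext => n; rewrite nf_probE//; congr (_ - _).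
  by apply: expect_perm; rewrite perm_sym; have [] := LP' n.
rewrite -[X in _ --> X]subr0 -esc0; apply: cvgB; first exact: cvg_cst.
exact: process_cvg.
Qed.

Lemma AST_liouvilleP : AST step D <-> liouville step D.
Proof. by split; [exact: AST_liouville|exact: liouville_AST]. Qed.

End Liouville.

(** * Interleaving finitely many terminating components *)

Section Interleaving.
Variables (R : realType) (A : choiceType) (I : finType).
Variables (step : A -> multidist R A -> Prop) (Z : set A).
Hypotheses (Zstep : step_closed step Z) (Zliou : liouville step Z).

Definition upd (ts : I -> A) (i : I) (a : A) : I -> A :=
  fun j => if j == i then a else ts j.

Lemma updxx ts i a : upd ts i a i = a. Proof. by rewrite /upd eqxx. Qed.

Lemma upd_id ts i : upd ts i (ts i) = ts.
Proof. by apply/funext => j; rewrite /upd; case: eqP => [->|]. Qed.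

Lemma updC ts i j a b : i != j -> upd (upd ts i a) j b = upd (upd ts j b) i a.
Proof.
move=> ij; apply/funext => k; rewrite /upd; case: eqP => [->|//].
by rewrite eq_sym (negPf ij).
Qed.

Let ZI (ts : I -> A) := forall i, Z (ts i).

Let ZI_upd ts i a : ZI ts -> Z a -> ZI (upd ts i a).
Proof. by move=> tsZ Za j; rewrite /upd; case: eqP. Qed.

(* The components are released one at a time: for a fixed value a of the next
   component, h exceeds the best value M that one more step of that component
   can give only by a function which is subharmonic in the released ones. *)
Lemma liouville_interleaving_on (r : seq I) (h : (I -> A) -> R) :
  (forall ts, ZI ts -> 0 <= h ts <= 1) ->
  (forall ts, ZI ts -> forall e, 0 < e -> h ts <= e \/
    exists i (mu : multidist R A), [/\ i \in r, step (ts i) mu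
      & h ts <= expect mu (fun a => h (upd ts i a)) + e]) ->
  forall ts, ZI ts -> h ts <= 0.
Proof.
elim: r h => [|i r IH] h h01 hstep ts tsZ.
  apply: ler0_eps => e e0; have [//|[i [mu []]]] := hstep _ tsZ _ e0.
  by rewrite in_nil.
(* The other components range freely, so the supremum [M a] depends on [a] alone. *)
pose E a := [set x | exists ts (mu : multidist R A),
  [/\ Z a, ZI ts, step a mu & x = expect mu (fun b => h (upd ts i b))]].
have E1 a x : E a x -> x <= 1.
  move=> [ts' [mu [Za ts'Z st ->]]]; apply: (expect_fdist_le1 (Zstep Za st)) => b Zb.
  by have /andP[] := h01 _ (ZI_upd i ts'Z Zb).
have /choice[M MP] : forall a, exists s, _ := fun a => exists_sup0 (@E1 a).
have hM a ts' : Z a -> ZI ts' -> h (upd ts' i a) <= M a.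
  move=> Za ts'Z; have [/andP[M0 M1] ubM _] := MP a.
  pose k ts := Num.max 0 (h (upd ts i a) - M a).
  suff: k ts' <= 0 by rewrite /k ge_max lexx subr_le0.
  apply: IH ts'Z => {ts'} ts' ts'Z.
    rewrite le_max lexx ge_max ler01 /= lerBlDr.
    by have /andP[_ h1] := h01 _ (ZI_upd i ts'Z Za); rewrite (le_trans h1)// lerDl.
  move=> e e0; have := hstep _ (ZI_upd i ts'Z Za) _ e0.
  case=> [he|[j [mu [jr st hle]]]].
    by left; rewrite ge_max ltW//=; lra.
  (* A step of [i] itself yields at most [M a], so the excess is at most [e]; a step of another
     component carries over to [k]. *)
  have [ji|ji] := eqVneq j i.
    move: st hle; rewrite ji updxx => st hle.
    left; rewrite ge_max (ltW e0) /= lerBlDr addrC.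
    apply: le_trans hle _; rewrite lerD2r; apply: ubM.
    by exists (upd ts' i a), mu; split=> //; exact: ZI_upd.
  right; exists j, mu.
  have {}st : step (ts' j) mu by move: st; rewrite /upd (negPf ji).
  have muZ := Zstep (ts'Z j) st.
  split=> //; first by move: jr; rewrite inE (negPf ji).
  have kge b : Z b -> h (upd (upd ts' i a) j b) <= k (upd ts' j b) + M a.
    by move=> Zb; rewrite updC 1?eq_sym// -lerBlDr /k le_max lexx orbT.
  rewrite ge_max addr_ge0 ?(ltW e0)//=; last first.
    by apply: (expect_fdist_ge0 muZ) => b Zb; rewrite /k le_max lexx.
  rewrite lerBlDr addrAC; apply: le_trans hle _; rewrite lerD2r.
  rewrite -[X in _ + X](expect_fdist_const muZ) -expectD.
  exact: (ler_expect_fdist muZ).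
(* Taking the supremum over the other components leaves a function of one: [H a] is at most [M a],
   which a step nearly attains, and the expectation of [h] after it is at most that of [H]. *)
pose EH a := [set x | exists ts, [/\ Z a, ZI ts & x = h (upd ts i a)]].
have EH1 a x : EH a x -> x <= 1.
  by move=> [ts' [Za ts'Z ->]]; have /andP[] := h01 _ (ZI_upd i ts'Z Za).
have /choice[H HP] : forall a, exists s, _ := fun a => exists_sup0 (@EH1 a).
have Hsub : subharmonic step Z H.
  move=> a Za; have [H01 ubH Hsup] := HP a; split=> // e e0.
  have e20 : 0 < e / 2 by lra.
  have [?|[_ [[ts' [_ ts'Z ->]] Hle]]] := Hsup _ e20; first by left; lra.
  have hle := hM _ _ Za ts'Z; have [_ _ Msup] := MP a.
  have [?|[_ [[ts2 [mu [_ ts2Z st ->]]] Mle]]] := Msup _ e20; first by left; lra.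
  right; exists mu; split=> //.
  have : expect mu (fun b => h (upd ts2 i b)) <= expect mu H.
    apply: (ler_expect_fdist (Zstep Za st)) => b Zb.
    by have [_ ub _] := HP b; apply: ub; exists ts2.
  by lra.
apply: le_trans (Zliou Hsub (tsZ i)).
have [_ ub _] := HP (ts i); apply: ub; exists ts; split=> //.
by rewrite upd_id.
Qed.

Lemma liouville_interleaving (h : (I -> A) -> R) :
  (forall ts, ZI ts -> 0 <= h ts <= 1) ->
  (forall ts, ZI ts -> forall e, 0 < e -> h ts <= e \/
    exists i (mu : multidist R A), step (ts i) mu
      /\ h ts <= expect mu (fun a => h (upd ts i a)) + e) ->
  forall ts, ZI ts -> h ts <= 0.
Proof.
move=> h01 hstep; apply: (liouville_interleaving_on (r := enum I)) => //.
move=> ts tsZ e e0; have [|[i [mu [st hle]]]] := hstep ts tsZ e e0; first by left.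
by right; exists i, mu; rewrite mem_enum.
Qed.

End Interleaving.

(** * Terms *)

Section TermFacts.
Variables (F : Type) (ar : F -> nat).
Implicit Types (t u v w : term ar) (s : nat -> term ar) (S : set F).

(** The type of the arguments depends on the symbol, so [args] transports them along an equality of
    symbols, which proof irrelevance reduces to [erefl]. *)
Lemma TFun_inj f (ts us : 'I_(ar f) -> term ar) :
  TFun f ts = TFun f us -> ts = us.
Proof.
pose args t : 'I_(ar f) -> term ar :=
  if t is TFun g vs then
    if pselect (g = f) is left e then
      eq_rect g (fun g => 'I_(ar g) -> term ar) vs f e
    else ts
  else ts.
move=> /(congr1 args) /=; case: pselect => // e.
by rewrite (Prop_irrelevance e erefl).
Qed.

Definition root_in S t : Prop := if t is TFun f _ then S f else False.

Lemma terms_over_TFun S f (ts : 'I_(ar f) -> term ar) :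
  terms_over S (TFun f ts) <-> S f /\ forall i, terms_over S (ts i).
Proof.
split=> [H|[Sf tsS] g /= [->//|[i _ /tsS]]//].
by split=> [|i g gi]; apply: H; [left|right; exists i].
Qed.

Lemma subst_subst s s' t :
  subst s (subst s' t) = subst (fun x => subst s (s' x)) t.
Proof. by elim: t => //= f ts IH; congr TFun; apply/funext. Qed.

Lemma eq_in_subst s s' t :
  (forall x, vars t x -> s x = s' x) -> subst s t = subst s' t.
Proof.
elim: t => [x|f ts IH] /= ss'; first exact: ss'.
by congr TFun; apply/funext => i; apply: IH => x xi; apply: ss'; exists i.
Qed.

Lemma terms_over_subst S s t : terms_over S t ->
  (forall x, vars t x -> terms_over S (s x)) -> terms_over S (subst s t).
Proof.
elim: t => [x|f ts IH] /=; first by move=> _; apply.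
move=> /terms_over_TFun[Sf tsS] sS; apply/terms_over_TFun; split=> // i.
by apply: IH => // x xi; apply: sS; exists i.
Qed.

Lemma terms_over_subst_vars S s t x :
  terms_over S (subst s t) -> vars t x -> terms_over S (s x).
Proof.
elim: t => [y|f ts IH] /=; first by move=> sS ->.
by move=> /terms_over_TFun[_ tsS] [i _ /IH]; apply.
Qed.

Lemma subterm_at_nil t : subterm_at t [::] = Some t.
Proof. by case: t. Qed.

Lemma subterm_cat t u v pi pi' : subterm_at t pi = Some u ->
  subterm_at u pi' = Some v -> subterm_at t (pi ++ pi') = Some v.
Proof.
elim: pi t => [|i pi IH] [x|f ts] //=; [by move=> [<-]|by move=> [<-]|].
by case: insubP => // j _ _; exact: IH.
Qed.

Lemma subterm_subst s t u pi : subterm_at t pi = Some u ->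
  subterm_at (subst s t) pi = Some (subst s u).
Proof.
elim: pi t => [|i pi IH] t; first by rewrite !subterm_at_nil => -[<-].
by case: t => //= f ts; case: insubP => // j _ _; exact: IH.
Qed.

Lemma subterm_subst_inv s t v pi : subterm_at (subst s t) pi = Some v ->
  (exists u, [/\ subterm_at t pi = Some u, ~~ is_var u & v = subst s u]) \/
  exists x pi', subterm_at (s x) pi' = Some v.
Proof.
elim: pi t => [|i pi IH] [x|f ts] /=.
- by move=> sx; right; exists x, [::].
- by move=> [<-]; left; exists (TFun f ts).
- by move=> sx; right; exists x, (i :: pi).
- by case: insubP => // j _ _ /IH.
Qed.

Lemma terms_over_subterm S t u pi :
  terms_over S t -> subterm_at t pi = Some u -> terms_over S u.
Proof.
elim: pi t => [|i pi IH] [x|f ts] //= tS; [by case=> <-|by case=> <-|].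
case: insubP => // j _ _; apply: IH.
by have /terms_over_TFun[] := tS.
Qed.

Lemma terms_over_replace S t u pi :
  terms_over S t -> terms_over S u -> terms_over S (replace_at t pi u).
Proof.
elim: pi t => [|i pi IH] [x|f ts] //= /terms_over_TFun[Sf tsS] uS.
by apply/terms_over_TFun; split=> // j; case: eqP => // _; exact: IH.
Qed.

Lemma replace_at_nil t u : replace_at t [::] u = u.
Proof. by case: t. Qed.

Lemma replace_subst s t u w pi : subterm_at t pi = Some u ->
  replace_at (subst s t) pi (subst s w) = subst s (replace_at t pi w).
Proof.
elim: pi t => [|i pi IH] t; first by rewrite !replace_at_nil.
case: t => //= f ts; case: insubP => // j _ ji tu; congr TFun; apply/funext => k.
case: eqP => // ki; apply: IH; suff -> : k = j by [].
by apply: val_inj; rewrite /= ki ji.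
Qed.

(* A term is rebuilt by any substitution that attains its maximal subterms
   whose root lies outside S. *)
Lemma alien_decomposition S (N : set (term ar)) t :
  (forall f ts i, S f -> N (TFun f ts) -> N (ts i)) -> N t ->
  exists A : seq (term ar), (forall a, a \in A -> N a /\ ~ root_in S a) /\
    forall s, (forall a, a \in A -> exists x, s x = a) ->
      exists2 t', terms_over S t' & t = subst s t'.
Proof.
move=> Narg.
have alien u : N u -> ~ root_in S u ->
    exists A : seq (term ar), (forall a, a \in A -> N a /\ ~ root_in S a) /\
    forall s, (forall a, a \in A -> exists x, s x = a) ->
      exists2 t', terms_over S t' & u = subst s t'.
  move=> Nu Su; exists [:: u]; split=> [a|s sP]; first by rewrite inE => /eqP->.
  by have [x sx] := sP u (mem_head _ _); exists (TVar x).
elim: t => [x|f ts IH] Nt; first exact: alien.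
have [Sf|Sf] := pselect (S f); last exact: alien.
have /choice[A AP] := fun i => IH i (Narg _ _ i Sf Nt).
exists (flatten [seq A i | i <- enum 'I_(ar f)]); split=> [a /flatten_mapP[i _]|].
  by have [+ _] := AP i; apply.
move=> s sP.
have /choice[ts' ts'P] : forall i, exists t', terms_over S t' /\ ts i = subst s t'.
  move=> i; have [_ /(_ s)[a aA|t' t'S ->]] := AP i; last by exists t'.
  by apply: sP; apply/flatten_mapP; exists i; rewrite ?mem_enum.
exists (TFun f ts').
  by apply/terms_over_TFun; split=> // i; have [] := ts'P i.
by rewrite /=; congr TFun; apply/funext => i; have [] := ts'P i.
Qed.

(* Beyond the given list, s enumerates variables too large to occur in it. *)
Lemma injective_subst_attaining (N : set (term ar)) (A : seq (term ar)) :
  (forall x, N (TVar x)) -> (forall a, a \in A -> N a) ->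
  exists s, [/\ injective s, forall x, N (s x)
    & forall a, a \in A -> exists x, s x = a].
Proof.
move=> Nvar NA.
have [m mP] : exists m, forall x, TVar x \in A -> (x < m)%N.
  elim: A {NA} => [|a A [m mP]]; first by exists 0%N.
  exists (maxn m (if a is TVar y then y.+1 else 0%N)) => x.
  rewrite inE => /orP[/eqP <-|/mP xm]; first by rewrite leq_max leqnn orbT.
  by rewrite leq_max xm.
(* Without duplicates the initial segment of [s] is injective. *)
pose B := undup A.
exists (fun x => if (x < size B)%N then nth (TVar 0) B x else TVar (m + x)).
have inA x : (x < size B)%N -> nth (TVar 0) B x \in A.
  by move=> xB; rewrite -mem_undup mem_nth.
split=> [x y|x|a].
- case: ltnP => xB; case: ltnP => yB.
  + by move=> /eqP; rewrite nth_uniq ?undup_uniq// => /eqP.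
  + by move=> eq_xy; have := inA _ xB; rewrite eq_xy => /mP; rewrite ltnNge leq_addr.
  + by move=> eq_xy; have := inA _ yB; rewrite -eq_xy => /mP; rewrite ltnNge leq_addr.
  + by case=> /addnI.
- by case: ltnP => // /inA/NA.
- rewrite -mem_undup -/B => aB; exists (index a B).
  by rewrite index_mem aB nth_index.
Qed.

(** No [s x] has its root in [S], so the root of an instance shows whether the term has a variable
    or a symbol there; injectivity of [s] then identifies the variables. *)
Lemma subst_inj S s : injective s -> (forall x, ~ root_in S (s x)) ->
  forall t u, terms_over S t -> terms_over S u -> subst s t = subst s u -> t = u.
Proof.
move=> sinj sS; elim=> [x|f ts IH] [y|g us] /=.
- by move=> _ _ /sinj ->.
- by move=> _ /terms_over_TFun[Sg _] sx; have := sS x; rewrite sx.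
- by move=> /terms_over_TFun[Sf _] _ sy; have := sS y; rewrite -sy.
- move=> /terms_over_TFun[_ tsS] /terms_over_TFun[_ usS] eq_tu.
  have fg : f = g by case: eq_tu.
  case: g / fg us usS eq_tu => us usS /TFun_inj eq_tu.
  congr TFun; apply/funext => i; apply: IH => //.
  exact: (congr1 (fun h => h i) eq_tu).
Qed.

(** Symbols of [l] cannot be matched inside some [s x], so the variables of [l] receive instances of
    subterms of [u]. *)
Lemma match_subst S s s' l u :
  injective s -> (forall x, ~ root_in S (s x)) ->
  terms_over S u -> terms_over S l -> subst s u = subst s' l ->
  exists2 s'', u = subst s'' l &
    forall x, vars l x -> subst s (s'' x) = s' x.
Proof.
move=> sinj sS uS lS eq_ul.
have preim x : vars l x -> exists2 w, terms_over S w & subst s w = s' x.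
  elim: l u uS lS eq_ul => [y|f ls IH] u uS /= lS eq_ul.
    by move=> ->; exists u.
  move=> [i _ xi]; case: u uS eq_ul => [y|g us] uS eq_ul.
    have /terms_over_TFun[Sf _] := lS.
    by have := sS y; rewrite -[s y]/(subst s (TVar y)) eq_ul.
  have fg : g = f by case: eq_ul.
  case: f / fg ls IH lS eq_ul i xi => ls IH lS /TFun_inj eq_ul i xi.
  have /terms_over_TFun[_ lsS] := lS; have /terms_over_TFun[_ usS] := uS.
  by apply: (IH i (us i)) => //; exact: (congr1 (fun h => h i) eq_ul).
have /choice[s'' s''P] : forall x, exists w, vars l x ->
    terms_over S w /\ subst s w = s' x.
  move=> x; have [/preim[w]|nx] := pselect (vars l x); first by exists w.
  by exists (TVar 0).
exists s'' => [|x /s''P[]//].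
(* If [l] repeats a variable, its occurrences must agree; this comes from the injectivity of
   [subst s] on terms over [S]. *)
apply: (subst_inj sinj sS) => //.
  by apply: terms_over_subst => // x /s''P[].
rewrite eq_ul subst_subst; apply: eq_in_subst => x.
by move=> /s''P[].
Qed.

End TermFacts.

(** * Innermost rewriting in a subsystem *)

Section PTRSFacts.
Variables (R : realType) (F : Type) (ar : F -> nat).
Implicit Types (P Q : set (rule R ar)) (t u : term ar).

Lemma terms_over_lhs P l nu : P (l, nu) -> terms_over (signature P) l.
Proof. by move=> Pl f lf; exists l, nu; split=> //; left. Qed.

Lemma terms_over_rhs P l nu p r :
  P (l, nu) -> (p, r) \in nu -> terms_over (signature P) r.
Proof.
by move=> Pl rnu f rf; exists l, nu; split=> //; right; exists p, r.
Qed.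

Lemma step_closed_innermost P : is_PTRS P ->
  step_closed (innermost P) (terms_over (signature P)).
Proof.
move=> [_ PP] t _ tP [pi [l [nu [s [Pl tl _ ->]]]]].
have [lvar nuD nuvars] := PP _ _ Pl.
apply: (fdist_map nuD) => p r rnu; apply: terms_over_replace => //.
apply: terms_over_subst; first exact: terms_over_rhs Pl rnu.
move=> x /(nuvars _ _ rnu); apply: terms_over_subst_vars.
exact: terms_over_subterm tP tl.
Qed.

Lemma normal_subterm P t u pi :
  normal_term P t -> subterm_at t pi = Some u -> normal_term P u.
Proof.
move=> nt tu [pi' [l [nu [s [Pl ul]]]]]; apply: nt.
by exists (pi ++ pi'), l, nu, s; split=> //; exact: subterm_cat tu ul.
Qed.

Lemma subterm_arg f (ts : 'I_(ar f) -> term ar) i :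
  subterm_at (TFun f ts) [:: val i] = Some (ts i).
Proof. by rewrite /= valK subterm_at_nil. Qed.

Lemma normal_TVar P x : is_PTRS P -> normal_term P (TVar x).
Proof.
move=> [_ PP] [[|i pi] [l [nu [s [Pl //]]]]]; rewrite subterm_at_nil => -[].
by case: l Pl => // y /PP[].
Qed.

(** A root redex is innermost only if the arguments are normal; any other redex lies within one
    argument. *)
Lemma innermost_TFun P f (ts : 'I_(ar f) -> term ar) mu :
  innermost P (TFun f ts) mu ->
  (forall i, normal_term P (ts i)) \/
  exists i nu, innermost P (ts i) nu /\
    mu = multidist_map (fun a => TFun f (upd ts i a)) nu.
Proof.
move=> [[|i pi] [l [nu [s [Pl]]]]].
  rewrite subterm_at_nil => -[<-] nargs _; left => i.
  exact: nargs (subterm_arg ts i).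
rewrite /=; case: insubP => // j _ ji tl nargs ->; right.
exists j, (multidist_map (fun r => replace_at (ts j) pi (subst s r)) nu).
split; first by exists pi, l, nu, s.
rewrite multidist_map_comp; apply: eq_multidist_map => p r _ /=.
congr TFun; apply/funext => k; rewrite /upd -ji.
by rewrite (inj_eq val_inj); case: eqP => // ->.
Qed.

(** The union of all closed sets with the Liouville property; it inherits both properties, hence is
    the largest such set. *)
Definition safe P : set (term ar) :=
  [set t | exists Z : set (term ar),
    [/\ step_closed (innermost P) Z, liouville (innermost P) Z & Z t]].

Lemma step_closed_safe P : step_closed (innermost P) (safe P).
Proof.
move=> t mu [Z [Zstep Zliou Zt]] st; apply: fdist_sub (Zstep _ _ Zt st).
by move=> u Zu; exists Z; split.
Qed.

Lemma liouville_safe P : liouville (innermost P) (safe P).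
Proof.
move=> g gsub t [Z [Zstep Zliou Zt]]; apply: (Zliou) Zt.
by apply: subharmonic_sub gsub => u Zu; exists Z; split.
Qed.

(** * A subsystem owning all rules rooted in its signature *)

Section Subsystem.
Variables P Q : set (rule R ar).
Hypotheses (PP : is_PTRS P) (QQ : is_PTRS Q) (QP : Q `<=` P).
Hypothesis Qroot :
  forall l nu, P (l, nu) -> root_in (signature Q) l -> Q (l, nu).

Lemma subsystem_rule l nu s :
  P (l, nu) -> terms_over (signature Q) (subst s l) -> Q (l, nu).
Proof.
move=> Pl lQ; apply: Qroot => //; case: PP => _ /(_ _ _ Pl)[].
by case: l lQ {Pl} => //= f ls /terms_over_TFun[].
Qed.

(** Normality for [Q] must give normality for [P]: a rule of [P] that matches inside a term over the
    signature of [Q] is a rule of [Q]. *)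
Lemma innermost_subsystem t mu : terms_over (signature Q) t ->
  innermost Q t mu -> innermost P t mu.
Proof.
move=> tQ [pi [l [nu [s [Ql tl nargs ->]]]]].
exists pi, l, nu, s; split=> //; first exact: QP.
move=> pi' u pi'0 lu [pi2 [l2 [nu2 [s2 [Pl2 ul2]]]]].
apply: (nargs _ _ pi'0 lu); exists pi2, l2, nu2, s2; split=> //.
apply: (subsystem_rule (s := s2)) => //.
apply: terms_over_subterm ul2; apply: terms_over_subterm lu.
exact: terms_over_subterm tl.
Qed.

Lemma liouville_subsystem (D : set (term ar)) :
  terms_over (signature Q) `<=` D ->
  liouville (innermost P) D -> liouville (innermost Q) (terms_over (signature Q)).
Proof.
move=> QD; apply: liouville_restrict QD (step_closed_innermost QQ) _.
exact: innermost_subsystem.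
Qed.

(** Values for the variables of an abstracted term: nothing rewrites inside them, and no symbol of a
    left-hand side of [Q] matches at their root. *)
Definition alien : set (term ar) :=
  [set a | normal_term P a /\ ~ root_in (signature Q) a].

Lemma alien_TVar x : alien (TVar x).
Proof. by split=> //; exact: normal_TVar. Qed.

(** No redex lies inside a normal [s x], so its root is a symbol of [t] and the rule belongs to [Q];
    by [match_subst] the match factors through [s]. The step of [t] is innermost because a [Q]-redex
    in [t] stays a redex in the instance. *)
Lemma innermost_subst_inv s t mu :
  injective s -> (forall x, alien (s x)) -> terms_over (signature Q) t ->
  innermost P (subst s t) mu ->
  exists nu, innermost Q t nu /\ mu = multidist_map (subst s) nu.
Proof.
move=> sinj salien tQ [pi [l [nu [s1 [Pl tl nargs ->]]]]].
have [[u [tu uvar ul]]|[x [pi' xl]]] := subterm_subst_inv tl; last first.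
  by have [[]] := salien x; exists pi', l, nu, s1.
have uQ := terms_over_subterm tQ tu.
have [_ /(_ _ _ Pl)[lvar _ nuvars]] := PP.
have Ql : Q (l, nu).
  apply: Qroot => //; case: l lvar ul {Pl tl nargs nuvars} => // f ls _.
  by case: u uvar uQ {tu} => //= g us _ /terms_over_TFun[Qg _] [fg _]; rewrite fg.
have [s2 uE s2E] := match_subst sinj (fun x => proj2 (salien x)) uQ
  (terms_over_lhs Ql) (esym ul).
exists (multidist_map (fun r => replace_at t pi (subst s2 r)) nu); split.
  exists pi, l, nu, s2; split=> //; first by rewrite tu uE.
  move=> pi' w pi'0 lw [pi2 [l2 [nu2 [s3 [Ql2 wl2]]]]].
  have lw' : subterm_at (subst s1 l) pi' = Some (subst s w).
    by rewrite ul uE; exact: subterm_subst.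
  apply: (nargs _ _ pi'0 lw'); exists pi2, l2, nu2, (fun x => subst s (s3 x)).
  by split; [exact: QP|rewrite -subst_subst; exact: subterm_subst].
rewrite multidist_map_comp; apply: eq_multidist_map => p r rnu /=.
rewrite -(replace_subst _ _ tu) subst_subst; congr replace_at.
by apply: eq_in_subst => x /(nuvars _ _ rnu)/s2E.
Qed.

Definition alien_instances : set (term ar) :=
  [set u | exists s t, [/\ injective s, forall x, alien (s x),
                          terms_over (signature Q) t & u = subst s t]].

Lemma step_closed_alien_instances : step_closed (innermost P) alien_instances.
Proof.
move=> _ mu [s [t [sinj salien tQ ->]]] st.
have [nu [tnu ->]] := innermost_subst_inv sinj salien tQ st.
have nuQ := step_closed_innermost QQ tQ tnu.
apply: (fdist_map nuQ) => p r rnu; exists s, r; split=> //.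
exact: (fdist_supp nuQ rnu).
Qed.

(** For fixed [s], steps of an instance are instances of [Q]-steps, so [g \o subst s] is subharmonic
    for [Q]. *)
Lemma liouville_alien_instances :
  liouville (innermost Q) (terms_over (signature Q)) ->
  liouville (innermost P) alien_instances.
Proof.
move=> liou g gsub _ [s [t [sinj salien tQ ->]]].
apply: (liou (g \o subst s)) tQ => {t} t tQ /=.
have [|g01 gstep] := gsub (subst s t); first by exists s, t.
split=> // e /gstep[|[mu [st gle]]]; first by left.
right; have [nu [tnu muE]] := innermost_subst_inv sinj salien tQ st.
by exists nu; split=> //; rewrite -expect_map -muE.
Qed.

Lemma alien_instances_TFun f (ts : 'I_(ar f) -> term ar) :
  signature Q f -> (forall i, normal_term P (ts i)) ->
  alien_instances (TFun f ts).
Proof.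
move=> Qf nts.
(* The term itself may be reducible; having its root in the signature of [Q], it is never one of the
   aliens. *)
pose N u := normal_term P u \/ u = TFun f ts.
have Narg g us i : signature Q g -> N (TFun g us) -> N (us i).
  move=> _ [nu|eq_us]; left; first exact: normal_subterm nu (subterm_arg us i).
  pose args u := if u is TFun h vs then range vs else set0.
  have : args (TFun g us) (us i) by exists i.
  by rewrite eq_us => -[j _ <-].
have [|A [AN Adec]] := alien_decomposition (t := TFun f ts) Narg; first by right.
have Aalien a : a \in A -> alien a.
  by move=> /AN[[na|->]] //; split.
have [s [sinj salien sA]] := injective_subst_attaining alien_TVar Aalien.
by have [t tQ tE] := Adec _ sA; exists s, t.
Qed.

Lemma alien_instances_TVar x : alien_instances (TVar x).
Proof.
by exists TVar, (TVar x); split=> // [y z []//|y]; exact: alien_TVar.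
Qed.

Hypothesis Qliou : liouville (innermost Q) (terms_over (signature Q)).

Lemma safe_TVar x : safe P (TVar x).
Proof.
exists alien_instances; split; [exact: step_closed_alien_instances| |].
  exact: liouville_alien_instances.
exact: alien_instances_TVar.
Qed.

(** A step either rewrites one argument, and interleaving applies, or finds all arguments normal;
    then the term is an alien instance, where [g] is already at most 0. *)
Lemma safe_TFun f (ts : 'I_(ar f) -> term ar) :
  signature Q f -> (forall i, safe P (ts i)) -> safe P (TFun f ts).
Proof.
move=> Qf tsS.
(* Alien instances are included because a step at the root may destroy the form [TFun f us]. *)
pose Z u := alien_instances u \/
  exists us, (forall i, safe P (us i)) /\ u = TFun f us.
exists Z; split; last by right; exists ts.
- have closed_alien u mu : alien_instances u -> innermost P u mu -> is_fdist Z mu.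
    move=> au /(step_closed_alien_instances au); apply: fdist_sub.
    by move=> v; left.
  move=> u mu [au|[us [usS ->]] st]; first exact: closed_alien.
  have [nus|[i [nu [ist ->]]]] := innermost_TFun st.
    exact: closed_alien (alien_instances_TFun Qf nus) st.
  have nuS := step_closed_safe (usS i) ist.
  apply: (fdist_map nuS) => p r rnu; right; exists (upd us i r); split=> // j.
  by rewrite /upd; case: eqP => // _; exact: (fdist_supp nuS rnu).
- move=> g gsub.
  have galien u : alien_instances u -> g u <= 0.
    apply: (liouville_alien_instances Qliou).
    by apply: subharmonic_sub gsub => v; left.
  move=> _ [/galien//|[us [usS ->]]].
  have ZTFun vs : (forall i, safe P (vs i)) -> Z (TFun f vs) by right; exists vs.
  apply: (liouville_interleaving (@step_closed_safe P) (@liouville_safe P)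
    (h := fun vs => g (TFun f vs))) usS => vs vsS.
    by have [] := gsub _ (ZTFun _ vsS).
  move=> e e0; have [_ /(_ _ e0)[|[mu [st gle]]]] := gsub _ (ZTFun _ vsS).
    by left.
  have [nvs|[i [nu [ist muE]]]] := innermost_TFun st.
    by left; apply: le_trans (galien _ (alien_instances_TFun Qf nvs)) (ltW e0).
  by right; exists i, nu; split=> //; move: gle; rewrite muE expect_map.
Qed.

End Subsystem.
End PTRSFacts.

(** * The union of two systems with disjoint signatures *)

Section Union.
Variables (R : realType) (F : Type) (ar : F -> nat) (P1 P2 : set (rule R ar)).

Lemma is_PTRS_union : is_PTRS P1 -> is_PTRS P2 -> is_PTRS (P1 `|` P2).
Proof.
move=> [c1 h1] [c2 h2]; split; last by move=> l mu [/h1|/h2].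
by rewrite -bigcup2E; apply: bigcup_countable => // -[|[|n]] _ /=.
Qed.

Lemma signature_union : signature (P1 `|` P2) = signature P1 `|` signature P2.
Proof.
apply/seteqP; split=> f.
  by move=> [l [mu [[Pl|Pl] lf]]]; [left|right]; exists l, mu.
by move=> [|] [l [mu [Pl lf]]]; exists l, mu; split=> //; [left|right].
Qed.

Lemma disjoint_rule_root l nu : signature P1 `&` signature P2 = set0 ->
  (P1 `|` P2) (l, nu) -> root_in (signature P1) l -> P1 (l, nu).
Proof.
move=> disj [//|P2l]; case: l P2l => //= f ls P2l P1f; exfalso.
have : (signature P1 `&` signature P2) f.
  by split=> //; exists (TFun f ls), nu; split=> //; left; left.
by rewrite disj.
Qed.

End Union.

Theorem theorem7p2 (R : realType) (F : Type) (ar : F -> nat)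
    (P1 P2 : set (rule R ar)) (hP1 : is_PTRS P1) (hP2 : is_PTRS P2)
    (hdisj : signature P1 `&` signature P2 = set0) :
  innermost_AST (P1 `|` P2) <-> innermost_AST P1 /\ innermost_AST P2.
Proof.
have hP := is_PTRS_union hP1 hP2.
have root1 l nu := @disjoint_rule_root _ _ _ P1 P2 l nu hdisj.
have root2 l nu : (P1 `|` P2) (l, nu) -> root_in (signature P2) l -> P2 (l, nu).
  by rewrite setUC; apply: disjoint_rule_root; rewrite setIC.
rewrite /innermost_AST !AST_liouvilleP; try exact: step_closed_innermost.
split=> [liou|[liou1 liou2]].
  by split; apply: liouville_subsystem liou => // t tP f /tP;
    rewrite signature_union; [left|right].
(* The owner of the root symbol decides which system plays the role of [Q]; for a variable either
   would do. *)
have allsafe t : terms_over (signature (P1 `|` P2)) t -> safe (P1 `|` P2) t.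
  elim: t => [x _|f ts IH].
    by apply: (safe_TVar (Q := P1)) => // ? ?; left.
  rewrite terms_over_TFun signature_union => -[Pf tsP].
  have {tsP}tsS i : safe (P1 `|` P2) (ts i) by apply: IH; rewrite signature_union.
  by case: Pf => Pf; [apply: (safe_TFun (Q := P1))|apply: (safe_TFun (Q := P2))];
    move=> // ? ?; [left|right].
apply: liouville_restrict allsafe (step_closed_innermost hP) _
  (@liouville_safe _ _ _ _) => //.
Qed.
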